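(* The category $\mathbf{DLat}$ of distributive lattices and lattice homomorphisms and the category $\mathbf{S}$ of abstract spectra are dual (i.e. $\mathbf{DLat}$ is equivalent to the opposite category of $\mathbf{S}$).
   Context: Objects of $\mathbf{DLat}$ are distributive lattices with $0$ and $1$ (not required to be distinct); morphisms are lattice homomorphisms preserving $0$ and $1$. Compact means that every open cover has a finite subcover. For a bitopological space $(S,\mathcal{T}^+,\mathcal{T}^-)$ (a set with two topologies) put $\mathcal{L}^+=\{U\in\mathcal{T}^+: S\setminus U\in\mathcal{T}^-\}$ and $\mathcal{L}^-=\{U\in\mathcal{T}^-: S\setminus U\in\mathcal{T}^+\}$. A non-empty bitopological space is an abstract spectrum if: (SP1) $\mathcal{L}^+$ is a base for $\mathcal{T}^+$ and $\mathcal{L}^-$ is a base for $\mathcal{T}^-$; (SP2) if $F\subseteq S$ and $S\setminus F\in\mathcal{T}^+$ (resp. $S\setminus F\in\mathcal{T}^-$) then $F$ is a compact subset of $(S,\mathcal{T}^-)$ (resp. of $(S,\mathcal{T}^+)$); (SP3) at least one of $(S,\mathcal{T}^+)$, $(S,\mathcal{T}^-)$ is a $T_0$-space. Objects of $\mathbf{S}$ are abstract spectra; a morphism $(S_1,\mathcal{T}_1^+,\mathcal{T}_1^-)\to(S_2,\mathcal{T}_2^+,\mathcal{T}_2^-)$ is a function $f:S_1\to S_2$ continuous both from $(S_1,\mathcal{T}_1^+)$ to $(S_2,\mathcal{T}_2^+)$ and from $(S_1,\mathcal{T}_1^-)$ to $(S_2,\mathcal{T}_2^-)$.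
   Formalization: As stated the duality fails: the one-element lattice is terminal in DLat, but S (non-empty spectra) has no initial object. Proved instead: DLat is dual to abstract spectra with the empty space admitted, and S is dual to the distributive lattices with 0 ≠ 1. *)

(* Defs.v *)
From HB Require Import structures.
From mathcomp Require Import all_boot all_order.
From mathcomp Require Import boolp classical_sets topology.

Set Implicit Arguments.
Unset Strict Implicit.
Unset Printing Implicit Defensive.

Import Order.Theory.

Local Open Scope classical_set_scope.
Local Open Scope order_scope.

Record category := Category {
  obj :> Type;
  hom : obj -> obj -> Type;
  idc : forall A, hom A A;
  comp : forall A B C, hom B C -> hom A B -> hom A C;
  compA : forall A B C D (h : hom C D) (g : hom B C) (f : hom A B),
    comp h (comp g f) = comp (comp h g) f;
  comp1c : forall A B (f : hom A B), comp (idc B) f = f;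
  compc1 : forall A B (f : hom A B), comp f (idc A) = f }.
Arguments hom {c} A B.
Arguments idc {c} A.
Arguments comp {c A B C} g f.

Definition op (C : category) : category :=
  @Category C (fun A B => hom B A) (fun A => idc A)
    (fun _ _ _ g f => comp f g)
    (fun _ _ _ _ h g f => esym (compA f g h))
    (fun _ _ f => compc1 f) (fun _ _ f => comp1c f).

Definition full_sub (C : category) (P : C -> Prop) : category :=
  @Category {A : C | P A} (fun A B => hom (sval A) (sval B))
    (fun A => idc (sval A)) (fun _ _ _ g f => comp g f)
    (fun _ _ _ _ h g f => compA h g f)
    (fun _ _ f => comp1c f) (fun _ _ f => compc1 f).

Record functor (C D : category) := Functor {
  fobj :> C -> D;
  fmap : forall A B, hom A B -> hom (fobj A) (fobj B);
  fmap1 : forall A, fmap (idc A) = idc (fobj A);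
  fmapM : forall A B E (g : hom B E) (f : hom A B),
    fmap (comp g f) = comp (fmap g) (fmap f) }.
Arguments fmap {C D} F {A B} f : rename.

Definition id_functor (C : category) : functor C C :=
  @Functor C C id (fun _ _ f => f) (fun _ => erefl) (fun _ _ _ _ _ => erefl).

Lemma comp_functor1 (C D E : category) (G : functor D E) (F : functor C D) A :
  fmap G (fmap F (idc A)) = idc (G (F A)).
Proof. by rewrite !fmap1. Qed.

Lemma comp_functorM (C D E : category) (G : functor D E) (F : functor C D)
    (X Y Z : C) (g : hom Y Z) (f : hom X Y) :
  fmap G (fmap F (comp g f)) = comp (fmap G (fmap F g)) (fmap G (fmap F f)).
Proof. by rewrite !fmapM. Qed.

Definition comp_functor (C D E : category) (G : functor D E) (F : functor C D)
    : functor C E :=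
  @Functor C E (fun A => G (F A)) (fun _ _ f => fmap G (fmap F f))
    (comp_functor1 G F) (comp_functorM G F).

Definition is_iso (C : category) (A B : C) (f : hom A B) :=
  exists g : hom B A, comp g f = idc A /\ comp f g = idc B.

Definition nat_iso (C D : category) (F G : functor C D) :=
  exists eta : forall A : C, hom (F A) (G A),
    (forall (A B : C) (f : hom A B),
       comp (eta B) (fmap F f) = comp (fmap G f) (eta A)) /\
    (forall A : C, is_iso (eta A)).

Definition equivalent (C D : category) :=
  exists (F : functor C D) (G : functor D C),
    nat_iso (comp_functor G F) (id_functor C) /\
    nat_iso (comp_functor F G) (id_functor D).

Definition dual (C D : category) := equivalent C (op D).

(* [tbDistrLatticeType] does not force \bot != \top.  The display is a phantom
   argument, so fixing it loses no lattice. *)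
Definition dlat := tbDistrLatticeType (Order.Disp tt tt).

(* The library's {tblmorphism L -> M} only asks for preservation of \bot and
   \top, not of meets and joins. *)
Definition dlat_morphism (L M : dlat) (f : L -> M) :=
  [/\ {morph f : x y / x `&` y}, {morph f : x y / x `|` y},
      f \bot = \bot & f \top = \top].

Definition dlat_hom (L M : dlat) := {f : L -> M | dlat_morphism f}.

Lemma dlat_morphism_id (L : dlat) : dlat_morphism (@id L).
Proof. by split. Qed.

Lemma dlat_morphism_comp (L M N : dlat) (g : dlat_hom M N) (f : dlat_hom L M) :
  dlat_morphism (sval g \o sval f).
Proof.
case: g f => g [gI gU g0 g1] [f [fI fU f0 f1]]; split=> [x y|x y||] /=.
- by rewrite fI gI.
- by rewrite fU gU.
- by rewrite f0.
- by rewrite f1.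
Qed.

Definition DLat : category.
Proof.
refine (@Category dlat dlat_hom (fun L => exist _ _ (dlat_morphism_id L))
  (fun _ _ _ g f => exist _ _ (dlat_morphism_comp g f)) _ _ _).
- by move=> *; apply: eq_exist.
- by move=> A B [f ?]; exact: eq_exist.
- by move=> A B [f ?]; exact: eq_exist.
Defined.

(* One carrier with two topologies, given as two instances of the library's
   topological structure. *)
Record bitop := Bitop {
  bitop_sort :> Type;
  pos_class : Topological.axioms_ bitop_sort;
  neg_class : Topological.axioms_ bitop_sort }.

Definition pos (S : bitop) : topologicalType := Topological.Pack (pos_class S).
Definition neg (S : bitop) : topologicalType := Topological.Pack (neg_class S).

Definition bicontinuous (S1 S2 : bitop) (f : S1 -> S2) :=
  continuous (f : pos S1 -> pos S2) /\ continuous (f : neg S1 -> neg S2).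

Definition bitop_hom (S1 S2 : bitop) := {f : S1 -> S2 | bicontinuous f}.

Lemma bicontinuous_id (S : bitop) : bicontinuous (@id S).
Proof. by split=> x A. Qed.

Lemma bicontinuous_comp (S1 S2 S3 : bitop)
    (g : bitop_hom S2 S3) (f : bitop_hom S1 S2) :
  bicontinuous (sval g \o sval f).
Proof.
case: g f => g [gpos gneg] [f [fpos fneg]]; split => x.
- by apply: (@continuous_comp (pos S1) (pos S2) (pos S3)); [exact: fpos | exact: gpos].
- by apply: (@continuous_comp (neg S1) (neg S2) (neg S3)); [exact: fneg | exact: gneg].
Qed.

Definition BiTop : category.
Proof.
refine (@Category bitop bitop_hom (fun S => exist _ _ (bicontinuous_id S))
  (fun _ _ _ g f => exist _ _ (bicontinuous_comp g f)) _ _ _).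
- by move=> *; apply: eq_exist.
- by move=> A B [f ?]; exact: eq_exist.
- by move=> A B [f ?]; exact: eq_exist.
Defined.

Definition Lpos (S : bitop) : set (set S) :=
  [set U | open (U : set (pos S)) /\ open (~` U : set (neg S))].
Definition Lneg (S : bitop) : set (set S) :=
  [set U | open (U : set (neg S)) /\ open (~` U : set (pos S))].
Arguments Lpos : clear implicits.
Arguments Lneg : clear implicits.

Definition SP1 (S : bitop) :=
  basis (Lpos S : set (set (pos S))) /\ basis (Lneg S : set (set (neg S))).

Definition SP2 (S : bitop) := forall F : set S,
  (open (~` F : set (pos S)) -> cover_compact (F : set (neg S))) /\
  (open (~` F : set (neg S)) -> cover_compact (F : set (pos S))).

Definition SP3 (S : bitop) :=
  kolmogorov_space (pos S) \/ kolmogorov_space (neg S).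

Definition SP (S : bitop) := [/\ SP1 S, SP2 S & SP3 S].

Definition abstract_spectrum (S : bitop) := [set: S] !=set0 /\ SP S.

Definition AbsSpec : category := full_sub (C := BiTop) abstract_spectrum.

(* The one-element lattice is terminal in DLat, whereas AbsSpec has no initial
   object: a nonempty space has two constant maps to the two-point discrete
   spectrum.  So the two categories match only if the empty space, for which
   [SP] holds vacuously, is admitted as the dual of the one-element lattice
   (AbsSpec0), or if that lattice is left out (DLat01). *)
Definition AbsSpec0 : category := full_sub (C := BiTop) SP.

Definition nontrivial (L : dlat) := (\bot : L) <> \top.

Definition DLat01 : category := full_sub (C := DLat) nontrivial.

(* Main.v *)
(** The dual of a lattice [L] is its set of prime filters, with positive topology
    generated by the sets [spec_pos x] of prime filters containing [x] and
    negative topology generated by their complements.  By Zorn's lemma, [A] and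
    [B] fail to be separated by a prime filter containing [B] and avoiding [A]
    only if a finite meet from [B] lies below a finite join from [A].  This one
    fact gives the compactness axiom, the injectivity of [x |-> spec_pos x],
    and its surjectivity onto [Lpos].  In the other direction, a point [x] of a
    bitopological space [S] is sent to the prime filter of all [U] in [Lpos S]
    containing [x]; this is injective by [SP1] and [SP3], surjective by [SP2],
    and the bases of [SP1] make the inverse continuous. *)

From HB Require Import structures.
From mathcomp Require Import all_boot all_order finmap.
From mathcomp Require Import boolp classical_sets topology.
Require Import Defs.

Set Implicit Arguments.
Unset Strict Implicit.
Unset Printing Implicit Defensive.

Import Order.Theory.

Local Open Scope order_scope.
Local Open Scope classical_set_scope.

(** * Natural isomorphisms and full subcategories *)

Lemma nat_iso_sym (C D : category) (F G : functor C D) :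
  nat_iso F G -> nat_iso G F.
Proof.
case=> eta [eta_nat eta_iso].
pose inv A := sval (cid (eta_iso A)).
have etaK A : comp (inv A) (eta A) = idc (F A).
  by rewrite /inv; case: (cid _) => ? [].
have invK A : comp (eta A) (inv A) = idc (G A).
  by rewrite /inv; case: (cid _) => ? [].
exists inv; split=> [A B f|A]; last by exists (eta A).
(* Pad with [comp (eta A) (inv A)], apply naturality of [eta], and cancel [inv B] against
   [eta B]. *)
by rewrite -[LHS]compc1 -(invK A) -compA [X in comp _ X]compA -eta_nat
  !compA etaK comp1c.
Qed.

Definition incl (C : category) (P : C -> Prop) : functor (full_sub P) C :=
  @Functor (full_sub P) C sval (fun _ _ f => f)
    (fun _ => erefl) (fun _ _ _ _ _ => erefl).

Definition corestrict (C D : category) (P : D -> Prop) (F : functor C D)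
    (PF : forall A, P (F A)) : functor C (full_sub P) :=
  @Functor C (full_sub P) (fun A => exist P (F A) (PF A))
    (fun _ _ f => fmap F f) (fmap1 F) (fmapM F).

(** A full subcategory has the homs of [D], so the counit can be built and inverted in [D] itself,
    without transport along the inclusion. *)
Lemma equivalent_full_sub (C D : category) (P : D -> Prop) (F : functor C D)
    (PF : forall A, P (F A)) (G : functor (full_sub P) C) :
  nat_iso (id_functor C) (comp_functor G (corestrict PF)) ->
  nat_iso (comp_functor F G) (incl P) ->
  equivalent C (full_sub P).
Proof.
move=> unit_iso counit_iso; exists (corestrict PF), G; split=> //.
exact: nat_iso_sym.
Qed.

(** * Topology generated by a base *)

Section base_topology.
Variables (T I : Type) (B : I -> set T).

(** An alias of [T] with the two proofs as phantom arguments, so that the topological instance,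
    which depends on them, can be found from the type. *)
Definition base_space (B_cover : exists i, B i = setT)
  (B_meet : forall i j, exists k, B k = B i `&` B j) : Type := T.

Hypotheses (B_cover : exists i, B i = setT)
  (B_meet : forall i j, exists k, B k = B i `&` B j).

Definition base_open : set_system T :=
  [set U | forall x, U x -> exists2 i, B i x & B i `<=` U].

Let base_openT : base_open setT.
Proof. by case: B_cover => i Bi x _; exists i; rewrite ?Bi. Qed.

Let base_openI : setI_closed base_open.
Proof.
move=> U V Uo Vo x [/Uo[i ix iU] /Vo[j jx jV]].
by have [k Bk] := B_meet i j; exists k; rewrite Bk //; exact: setISS.
Qed.

Let base_open_bigU (J : Type) (f : J -> set T) :
  (forall j, base_open (f j)) -> base_open (\bigcup_j f j).
Proof.
move=> fo x [j _ /fo[i ix ij]]; exists i => //.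
by apply: subset_trans ij _; exact: bigcup_sup.
Qed.

HB.instance Definition _ := gen_eqMixin (base_space B_cover B_meet).
HB.instance Definition _ := gen_choiceMixin (base_space B_cover B_meet).
HB.instance Definition _ := isOpenTopological.Build (base_space B_cover B_meet)
  base_openT base_openI base_open_bigU.

Lemma open_baseE (U : set (base_space B_cover B_meet)) :
  open U = base_open U.
Proof. by []. Qed.

Lemma open_base i : open (B i : set (base_space B_cover B_meet)).
Proof. by rewrite open_baseE => x Bix; exists i. Qed.

Lemma continuous_base (S : topologicalType)
    (f : S -> base_space B_cover B_meet) :
  (forall i, open (f @^-1` B i)) -> continuous f.
Proof.
move=> fo; apply/continuousP => U; rewrite open_baseE => Uo.
rewrite (_ : f @^-1` U =
    \bigcup_(i in [set i | B i `<=` U]) (f @^-1` B i)); last first.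
  by apply/seteqP; split=> [x /Uo[i ? ?]|x [i iU /iU]] //; exists i.
by apply: bigcup_open => i _; exact: fo.
Qed.

(** [BB] may be larger than the generating family because [SP1] speaks of all of [Lpos] and
    [Lneg]. *)
Lemma basis_base (BB : set (set T)) :
  BB `<=` base_open -> (forall i, BB (B i)) ->
  basis (BB : set (set (base_space B_cover B_meet))).
Proof.
move=> BBo BBB; split=> // x U; rewrite /= nbhsE => -[V [Vo Vx] VU].
have [i Bix BiV] := Vo _ Vx.
by exists (B i) => //; exact: subset_trans BiV VU.
Qed.

End base_topology.

(** * Prime filters and their separation theorem *)

Section prime_filters.
Variable L : dlat.
Implicit Types (p A B : set L) (x y : L) (s t : seq L).

Definition prime_filter p :=
  [/\ p \top, ~ p \bot,
      forall x y, p (x `&` y)%O <-> p x /\ p y &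
      forall x y, p (x `|` y)%O <-> p x \/ p y].

Lemma prime_filter_le p x y : prime_filter p -> x <= y -> p x -> p y.
Proof. by case=> _ _ pI _ /meet_idPl <- /pI[]. Qed.

Lemma prime_filter_meets p s :
  prime_filter p -> p (\meet_(x <- s) x) <-> forall x, x \in s -> p x.
Proof.
case=> p1 _ pI _; elim: s => [|y s IHs]; first by rewrite big_nil.
rewrite big_cons pI IHs; split=> [[py ps] x|ps].
  by rewrite in_cons => /predU1P[->|/ps].
by split=> [|x xs]; apply: ps; rewrite in_cons ?eqxx ?xs ?orbT.
Qed.

Lemma prime_filter_joins p s :
  prime_filter p -> p (\join_(x <- s) x) <-> exists2 x, x \in s & p x.
Proof.
case=> _ p0 _ pU; elim: s => [|y s IHs].
  by rewrite big_nil; split=> // -[].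
rewrite big_cons pU IHs; split=> [[py|[x xs px]]|[x]].
- by exists y; rewrite ?mem_head.
- by exists x; rewrite ?in_cons ?xs ?orbT.
- by rewrite in_cons => /predU1P[->|xs] px; [left|right; exists x].
Qed.

(** Empty lists are allowed and stand for [\top] and [\bot]. *)
Definition separated A B := forall s t,
  (forall x, x \in s -> A x) -> (forall x, x \in t -> B x) ->
  ~~ (\meet_(x <- t) x <= \join_(x <- s) x).

(* Take [X] maximal such that [B `|` X] is still separated from [A]; maximality
   says that [X] consists exactly of the elements that are not [bad]. *)
Lemma prime_separation A B : separated A B ->
  exists p, [/\ prime_filter p, B `<=` p & A `<=` ~` p].
Proof.
move=> sepAB.
have [F FP Ftot|X [sepX maxX]] :=
    @Zorn_bigcup L [set X | separated A (B `|` X)].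
  move=> s t sA tBF.
  have [X FX tX] : exists2 X, X = set0 \/ F X &
      forall x, x \in t -> (B `|` X) x.
    elim: t tBF => [|y t IHt] tBF; first by exists set0; [left|].
    have [x xt|X FX tX] := IHt; first by apply: tBF; rewrite in_cons xt orbT.
    have [By|[Y FY Yy]] := tBF _ (mem_head y t).
      exists X => // x; rewrite in_cons => /predU1P[->|/tX//]; by left.
    have [YX|XY] : Y `<=` X \/ X `<=` Y.
      by case: FX => [->|FX]; [right|exact: Ftot].
    - exists X => // x; rewrite in_cons => /predU1P[->|/tX//].
      by right; exact: YX.
    - exists Y; first by right.
      move=> x; rewrite in_cons => /predU1P[->|/tX[]]; first by right.
        by left.
      by right; exact: XY.
  case: FX => [X0|/FP]; last by apply.
  by apply: sepAB => // x /tX[]//; rewrite X0.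
(* [y] is bad when adjoining it to [X] would destroy separation from [A]. *)
pose bad y := exists s t, [/\ forall x, x \in s -> A x,
  forall x, x \in t -> (B `|` X) x & (\meet_(x <- t) x `&` y)%O <= \join_(x <- s) x].
have badP y : (B `|` X) y -> ~ bad y.
  move=> Xy [s [t [sA tX]]]; apply/negP.
  have /(sepX s (y :: t) sA) : forall x, x \in y :: t -> (B `|` X) x.
    by move=> x; rewrite in_cons => /predU1P[->|/tX].
  by rewrite big_cons meetC.
have nbadP y : ~ bad y -> X y.
  move=> nbad; apply: contrapT => Xy.
  apply: (maxX (y |` X)).
    by split=> [|/(_ y)yX]; [exact: subsetUr|apply: Xy; apply: yX; left].
  (* Deleting [y] from the offending list leaves members of [B] and [X], and a single meet with [y]
     makes up for the deleted copies. *)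
  move=> s t sA tX; apply/negP => le_ts; apply: nbad.
  exists s, [seq x <- t | x != y]; split=> // [x|].
    rewrite mem_filter /= => /andP[/eqP yx /tX[]]; first by left.
    by case=> // ?; right.
  apply: le_trans le_ts; apply/meetsP_seq => x xt _.
  have [->|yx] := eqVneq x y; first exact: leIr.
  by apply: leIxl; apply: meets_inf_seq; rewrite // mem_filter /= yx.
have XE y : X y <-> ~ bad y.
  by split=> [Xy|/nbadP//]; apply: badP; right.
have badI x y : bad (x `&` y)%O <-> bad x \/ bad y.
  split=> [|[[s [t [sA tX le_ts]]]|[s [t [sA tX le_ts]]]]]; last first.
  - exists s, t; split=> //; apply: le_trans le_ts.
    by rewrite lexI leIl !leIx2 ?lexx ?orbT.
  - exists s, t; split=> //; apply: le_trans le_ts.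
    by rewrite lexI leIl !leIx2 ?lexx ?orbT.
  case=> s [t [sA tX]]; apply: contraPP => /not_orP[/nbadP Xx /nbadP Xy].
  have /(sepX s [:: x, y & t] sA) :
      forall z, z \in [:: x, y & t] -> (B `|` X) z.
    by move=> z; rewrite !in_cons => /or3P[/eqP->|/eqP->|/tX//]; right.
  by rewrite !big_cons meetA meetC => /negP.
have badU x y : bad (x `|` y)%O <-> bad x /\ bad y.
  split=> [[s [t [sA tX le_ts]]]|].
    by split; exists s, t; split=> //; apply: le_trans le_ts;
      rewrite leI2 ?leUl ?leUr.
  (* Concatenated witnesses work for the join, because distributivity splits the meet with it into
     two cases. *)
  case=> -[s [t [sA tX le_ts]]] [s' [t' [sA' tX' le_ts']]].
  exists (s ++ s'), (t ++ t'); split=> [z|z|].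
  - by rewrite mem_cat => /orP[/sA|/sA'].
  - by rewrite mem_cat => /orP[/tX|/tX'].
  rewrite !big_cat /= meetUr leUx.
  apply/andP; split; [apply: le_trans (le_trans le_ts (leUl _ _))|
    apply: le_trans (le_trans le_ts' (leUr _ _))];
    by rewrite leI2 // ?leIl ?leIr.
exists X; split; first split.
- apply/XE => -[s [t [sA tX]]]; rewrite meetx1; apply/negP; exact: sepX.
- move=> /XE; apply; exists [::], [::].
  by split=> //; rewrite meetx0 le0x.
- by move=> x y; rewrite !XE badI not_orP.
- by move=> x y; rewrite !XE badU not_andP.
- by move=> x Bx; apply: nbadP; apply: badP; left.
- move=> x Ax /XE; apply; exists [:: x], [::]; split=> // [y|].
    by rewrite inE => /eqP->.
  by rewrite big_seq1 leIr.
Qed.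

(** The form in which separation is applied: ruling out a prime filter produces a finite inequality,
    the algebraic source of finite subcovers. *)
Lemma prime_compactness A B :
  ~ (exists p, [/\ prime_filter p, B `<=` p & A `<=` ~` p]) ->
  exists s t, [/\ forall x, x \in s -> A x, forall x, x \in t -> B x &
    \meet_(x <- t) x <= \join_(x <- s) x].
Proof.
move=> noprime; apply: contrapT => nocover; apply: noprime.
apply: prime_separation => s t sA tB.
by apply/negP => le_ts; apply: nocover; exists s, t.
Qed.

End prime_filters.

(** * The spectrum of a distributive lattice *)

Section spectrum.
Variable L : dlat.
Implicit Types (x y : L).

Definition spec := {p : set L | prime_filter p}.

Lemma spec_inj (p q : spec) : sval p = sval q -> p = q.
Proof. by case: p q => p ? [q ?] /= pq; exact: eq_exist. Qed.

Definition spec_pos x : set spec := [set p | sval p x].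
Definition spec_neg x : set spec := ~` spec_pos x.

Lemma spec_posI x y : spec_pos (x `&` y)%O = spec_pos x `&` spec_pos y.
Proof. by apply/seteqP; split=> -[p [? ? pI ?]] /pI. Qed.

Lemma spec_posU x y : spec_pos (x `|` y)%O = spec_pos x `|` spec_pos y.
Proof. by apply/seteqP; split=> -[p [? ? ? pU]] /pU. Qed.

Lemma spec_pos0 : spec_pos \bot = set0.
Proof. by apply/seteqP; split=> -[p [? ? ? ?]]. Qed.

Lemma spec_pos1 : spec_pos \top = setT.
Proof. by apply/seteqP; split=> -[p [? ? ? ?]]. Qed.

Lemma spec_pos_cover : exists x, spec_pos x = setT.
Proof. by exists \top; rewrite spec_pos1. Qed.

Lemma spec_neg_cover : exists x, spec_neg x = setT.
Proof. by exists \bot; rewrite /spec_neg spec_pos0 setC0. Qed.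

Lemma spec_pos_meet x y : exists z, spec_pos z = spec_pos x `&` spec_pos y.
Proof. by exists (x `&` y)%O; rewrite spec_posI. Qed.

Lemma spec_neg_meet x y : exists z, spec_neg z = spec_neg x `&` spec_neg y.
Proof. by exists (x `|` y)%O; rewrite /spec_neg spec_posU setCU. Qed.

Definition Spec : bitop := @Bitop spec
  (Topological.class (base_space spec_pos_cover spec_pos_meet))
  (Topological.class (base_space spec_neg_cover spec_neg_meet)).

Lemma open_posE (U : set spec) :
  open (U : set (pos Spec)) <-> base_open spec_pos U.
Proof. by []. Qed.

Lemma open_negE (U : set spec) :
  open (U : set (neg Spec)) <-> base_open spec_neg U.
Proof. by []. Qed.

Lemma open_spec_pos x : open (spec_pos x : set (pos Spec)).
Proof. exact: (@open_base _ _ _ spec_pos_cover spec_pos_meet). Qed.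

Lemma open_spec_neg x : open (spec_neg x : set (neg Spec)).
Proof. exact: (@open_base _ _ _ spec_neg_cover spec_neg_meet). Qed.

Lemma Lpos_spec_pos x : Lpos Spec (spec_pos x).
Proof. split; [exact: open_spec_pos|exact: open_spec_neg]. Qed.

Lemma Lneg_spec_neg x : Lneg Spec (spec_neg x).
Proof.
split; first exact: open_spec_neg.
by have := @open_spec_pos x; rewrite -[spec_pos x]setCK.
Qed.

(** A prime filter containing every [x] with [spec_neg x] outside [U] and avoiding every [x] with
    [spec_pos x] inside [U] would lie neither in [U] nor in its complement. The resulting inequality
    traps [U] between a meet that contains it and a join contained in it. *)
Lemma Lpos_specP (U : set spec) : Lpos Spec U -> exists x, spec_pos x = U.
Proof.
case=> /open_posE Uo /open_negE Co.
have [[p [pp Bp Ap]]|s [t [sA tB le_ts]]] :=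
  @prime_compactness L [set x | spec_pos x `<=` U] [set x | spec_neg x `<=` ~` U].
  pose P : spec := exist _ p pp.
  have [UP|UP] := pselect (U P).
    by have [x px /Ap] := Uo _ UP; apply.
  by have [x npx /Bp] := Co _ UP.
exists (\join_(x <- s) x); apply/seteqP; split=> p.
  by move/(prime_filter_joins _ (svalP p)) => [x /sA xU px]; exact: xU.
move=> Up; apply: (prime_filter_le (svalP p) le_ts).
apply/(prime_filter_meets _ (svalP p)) => x /tB xU.
by apply: contrapT => /xU.
Qed.

(** A prime filter avoiding all [x] with [spec_pos x] disjoint from [F] lies in [F]; one containing
    all [x] with [spec_neg x] inside a member of the cover lies in no member. So none does both, and
    the finite inequality forces each point of [F] to miss some [x] in [t]. *)
Lemma compact_spec_neg (F : set spec) :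
  open (~` F : set (pos Spec)) -> cover_compact (F : set (neg Spec)).
Proof.
move=> /open_posE Fo I D f fo Ff.
have [[p [pp Bp Ap]]|s [t [sA tB le_ts]]] := @prime_compactness L
    [set x | spec_pos x `<=` ~` F]
    [set x | exists2 i, D i & spec_neg x `<=` f i].
  pose P : spec := exist _ p pp.
  have [/Ff[i Di fiP]|FP] := pselect (F P); last first.
    by have [x px /Ap] := Fo _ FP; apply.
  have /open_negE fio := fo _ Di.
  by have [x npx xf] := fio _ fiP; apply: npx; apply: Bp; exists i.
(* The index type has no default element, so [g] is option-valued, with no constraint off [t];
   [pmap] then extracts the indices. *)
have /choice[g gP] x : exists o, x \in t ->
    exists i, [/\ o = Some i, D i & spec_neg x `<=` f i].
  have [/tB[i Di xi]|] := boolP (x \in t); last by exists None.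
  by exists (Some i) => _; exists i.
exists [fset i in pmap g t]%fset.
  move=> i; rewrite !inE mem_pmap => /mapP[x xt gx].
  by have [j [gj Dj _]] := gP _ xt; move: gx; rewrite gj => -[->].
move=> p Fp.
have : ~ (forall x, x \in t -> sval p x).
  move/(prime_filter_meets _ (svalP p))/(prime_filter_le (svalP p) le_ts).
  by move/(prime_filter_joins _ (svalP p)) => [x /sA xF /xF].
move/existsNP => [x /not_implyP[xt npx]].
have [i [gx Di xi]] := gP _ xt; exists i; last exact: xi.
by rewrite /= !inE mem_pmap; apply/mapP; exists x.
Qed.

(** Dual to [compact_spec_neg]: the cover now supplies the list of joins, and [F] the list of
    meets. *)
Lemma compact_spec_pos (F : set spec) :
  open (~` F : set (neg Spec)) -> cover_compact (F : set (pos Spec)).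
Proof.
move=> /open_negE Fo I D f fo Ff.
have [[p [pp Bp Ap]]|s [t [sA tB le_ts]]] := @prime_compactness L
    [set x | exists2 i, D i & spec_pos x `<=` f i]
    [set x | spec_neg x `<=` ~` F].
  pose P : spec := exist _ p pp.
  have [/Ff[i Di fiP]|FP] := pselect (F P); last first.
    by have [x px /Bp] := Fo _ FP.
  have /open_posE fio := fo _ Di.
  by have [x px xf] := fio _ fiP; apply: (Ap x) => //; exists i.
have /choice[g gP] x : exists o, x \in s ->
    exists i, [/\ o = Some i, D i & spec_pos x `<=` f i].
  have [/sA[i Di xi]|] := boolP (x \in s); last by exists None.
  by exists (Some i) => _; exists i.
exists [fset i in pmap g s]%fset.
  move=> i; rewrite !inE mem_pmap => /mapP[x xs gx].
  by have [j [gj Dj _]] := gP _ xs; move: gx; rewrite gj => -[->].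
move=> p Fp.
have [x xs px] : exists2 x, x \in s & sval p x.
  apply/(prime_filter_joins _ (svalP p)).
  apply: (prime_filter_le (svalP p) le_ts).
  apply/(prime_filter_meets _ (svalP p)) => x /tB xF.
  by apply: contrapT => /xF.
have [i [gx Di xi]] := gP _ xs; exists i; last exact: xi.
by rewrite /= !inE mem_pmap; apply/mapP; exists x.
Qed.

Lemma kolmogorov_spec : kolmogorov_space (pos Spec).
Proof.
move=> p q /eqP pq.
have [x npq] : exists x, ~ (sval p x <-> sval q x).
  apply: contrapT => /forallNP nex; apply: pq; apply: spec_inj.
  by apply/funext => x; apply/propext; apply: contrapT; exact: nex.
have nbhs_pos (r : pos Spec) : spec_pos x r -> spec_pos x \in nbhs r.
  move=> rx; apply/mem_set; apply: open_nbhs_nbhs.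
  by split=> //; exact: open_spec_pos.
have [px|npx] := pselect (sval p x); have [qx|nqx] := pselect (sval q x);
    try by case: npq.
  by exists (spec_pos x); left; split; [exact: nbhs_pos|exact/mem_set].
by exists (spec_pos x); right; split; [exact: nbhs_pos|exact/mem_set].
Qed.

Lemma SP_Spec : SP Spec.
Proof.
split; last by left; exact: kolmogorov_spec.
  split.
    by apply: basis_base; [move=> U []|exact: Lpos_spec_pos].
  by apply: basis_base; [move=> U []|exact: Lneg_spec_neg].
by move=> F; split; [exact: compact_spec_neg|exact: compact_spec_pos].
Qed.

Lemma spec_pos_inj : injective spec_pos.
Proof.
suff le_spec x y : spec_pos x `<=` spec_pos y -> x <= y.
  by move=> x y xy; apply/le_anti; rewrite !le_spec ?xy.
move=> xy; have [[p [pp px py]]|s [t [sy tx le_ts]]] :=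
    @prime_compactness L [set y] [set x].
  by apply: (py y) => //; apply: (xy (exist _ p pp)); exact: px.
(* The lists hold only copies of [x] and of [y]; even if they are empty, [x] lies below the meet and
   the join below [y]. *)
apply: le_trans (le_trans le_ts _).
  by apply/meetsP_seq => z /tx->.
by apply/joinsP_seq => z /sy->.
Qed.

(** Without prime filters, [spec_pos] would identify [\bot] and [\top], against its injectivity. *)
Lemma Spec_nonempty : nontrivial L -> [set: Spec] !=set0.
Proof.
move=> nt; apply: contrapT => empty; apply: nt; apply: spec_pos_inj.
by apply/seteqP; split=> p; exfalso; apply: empty; exists p.
Qed.

End spectrum.

(** * The lattice of a bitopological space and its points *)

Section positive_lattice.
Variable S : bitop.

Definition Lpos_carrier := {U : set S | Lpos S U}.

Implicit Types U V W : Lpos_carrier.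

Lemma Lpos_carrier_inj U V : sval U = sval V -> U = V.
Proof. by case: U V => U ? [V ?] /= UV; exact: eq_exist. Qed.

HB.instance Definition _ := gen_eqMixin Lpos_carrier.
HB.instance Definition _ := gen_choiceMixin Lpos_carrier.

Lemma LposI (A B : set S) : Lpos S A -> Lpos S B -> Lpos S (A `&` B).
Proof.
move=> [Ao Ac] [Bo Bc]; split; first exact: (@openI (pos S)).
by have := @openU (neg S) _ _ Ac Bc; rewrite -setCI.
Qed.

Lemma LposU (A B : set S) : Lpos S A -> Lpos S B -> Lpos S (A `|` B).
Proof.
move=> [Ao Ac] [Bo Bc]; split; first exact: (@openU (pos S)).
by have := @openI (neg S) _ _ Ac Bc; rewrite -setCU.
Qed.

Lemma LnegC (A : set S) : Lneg S A -> Lpos S (~` A).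
Proof. by move=> [+ Ac]; rewrite -[in X in X -> _](setCK A). Qed.

Lemma Lpos0 : Lpos S set0.
Proof.
split; first exact: (@open0 (pos S)).
by have := @openT (neg S); rewrite -setC0.
Qed.

Lemma Lpos1 : Lpos S setT.
Proof.
split; first exact: (@openT (pos S)).
by have := @open0 (neg S); rewrite -setCT.
Qed.

Let le U V := `[< sval U `<=` sval V >].
Let lt U V := (V != U) && le U V.
Let meet U V : Lpos_carrier := exist _ _ (LposI (svalP U) (svalP V)).
Let join U V : Lpos_carrier := exist _ _ (LposU (svalP U) (svalP V)).

Let le_def U V : le U V = (meet U V == U).
Proof.
apply/asboolP/eqP => [UV|<- x []//].
by apply: Lpos_carrier_inj; exact/setIidPl.
Qed.

Let meetC : commutative meet.
Proof. by move=> U V; apply: Lpos_carrier_inj; exact: setIC. Qed.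

Let joinC : commutative join.
Proof. by move=> U V; apply: Lpos_carrier_inj; exact: setUC. Qed.

Let meetA : associative meet.
Proof. by move=> U V W; apply: Lpos_carrier_inj; exact: setIA. Qed.

Let joinA : associative join.
Proof. by move=> U V W; apply: Lpos_carrier_inj; exact: setUA. Qed.

Let joinKI V U : meet U (join U V) = U.
Proof. by rewrite (joinC U); apply: Lpos_carrier_inj; exact: setKU. Qed.

Let meetKU V U : join U (meet U V) = U.
Proof. by rewrite (meetC U); apply: Lpos_carrier_inj; exact: setKI. Qed.

Let meetUl : left_distributive meet join.
Proof. by move=> U V W; apply: Lpos_carrier_inj; exact: setIUl. Qed.

Let meetxx : idempotent_op meet.
Proof. by move=> U; apply: Lpos_carrier_inj; exact: setIid. Qed.

HB.instance Definition _ := @Order.isMeetJoinDistrLattice.Build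
  (Order.Disp tt tt) Lpos_carrier le lt meet join le_def (fun _ _ => erefl)
  meetC joinC meetA joinA joinKI meetKU meetUl meetxx.

Let le0 U : (exist _ _ Lpos0 : Lpos_carrier) <= U.
Proof. by apply/asboolP; exact: sub0set. Qed.

Let le1 U : U <= (exist _ _ Lpos1 : Lpos_carrier).
Proof. by apply/asboolP; exact: subsetT. Qed.

HB.instance Definition _ := @Order.hasBottom.Build _ Lpos_carrier _ le0.
HB.instance Definition _ := @Order.hasTop.Build _ Lpos_carrier _ le1.

Definition Lat : dlat := Lpos_carrier.

Lemma leLatE (U V : Lat) : (U <= V) <-> sval U `<=` sval V.
Proof. by split=> /asboolP. Qed.

Lemma nontrivial_Lat : [set: S] !=set0 -> nontrivial Lat.
Proof.
case=> x _ /(congr1 sval) bt; have : (setT : set S) x by [].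
by rewrite -[setT]/(sval (\top : Lat)) -bt.
Qed.

Lemma prime_filter_point (x : S) : prime_filter [set U : Lat | sval U x].
Proof. by split. Qed.

Definition point (x : S) : Spec Lat := exist _ _ (prime_filter_point x).

Lemma point_bicontinuous : bicontinuous point.
Proof.
split; apply: continuous_base => U; first by case: (svalP U).
by case: (svalP U).
Qed.

(** Points with the same image agree on [Lpos], and by complementation on [Lneg]. By [SP1] neither
    topology can then tell them apart, so it does not matter which one is $T_0$. *)
Lemma point_inj : SP1 S -> SP3 S -> injective point.
Proof.
move=> [[_ basep] [_ basen]] T0 x y pxy; apply: contrapT => xy.
have eqxy (U : set S) : Lpos S U -> (U x <-> U y).
  move=> LU; have : sval (point x) (exist _ U LU) = sval (point y) (exist _ U LU).
    by rewrite pxy.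
  by move=> /= ->.
have eqxyn (U : set S) : Lneg S U -> (U x <-> U y).
  by move=> /LnegC LU; have E := eqxy _ LU; split; apply: contraPP => /E.
case: T0 => T0.
  have /T0[A [[/set_mem nA /set_mem cA]|[/set_mem nA /set_mem cA]]] :
      (x : pos S) != y by exact/eqP.
    by have [U [LU /(eqxy _ LU) Uy] /(_ _ Uy)] := basep _ _ nA.
  by have [U [LU /(eqxy _ LU) Uy] /(_ _ Uy)] := basep _ _ nA.
have /T0[A [[/set_mem nA /set_mem cA]|[/set_mem nA /set_mem cA]]] :
    (x : neg S) != y by exact/eqP.
  by have [U [LU /(eqxyn _ LU) Uy] /(_ _ Uy)] := basen _ _ nA.
by have [U [LU /(eqxyn _ LU) Uy] /(_ _ Uy)] := basen _ _ nA.
Qed.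

(* With [F] the intersection of the complements of the [V] outside [p], the
   points representing [p] are those of [F] lying in every [U] of [p].  If
   there are none, negative compactness of [F] yields one [U] in [p] disjoint
   from [F], and positive compactness of [U] covers it by finitely many [V]
   outside [p], against primality. *)
Lemma point_surj : SP2 S -> forall p : Spec Lat, exists x, point x = p.
Proof.
move=> cpt p; have pP := svalP p.
pose G := \bigcup_(V in ~` sval p) sval V; pose F := ~` G.
have Fo : open (~` F : set (pos S)).
  have : open (G : set (pos S)).
    by apply: (@bigcup_open (pos S)) => V _; case: (svalP V).
  by rewrite -[G]setCK.
have [x Fx xp] : exists2 x, F x & forall U, sval p U -> sval U x.
  apply: contrapT => nox.
  have [||D Dp FD] := (cpt F).1 Fo Lat (sval p) (fun U => ~` sval U).
  - by move=> U _; case: (svalP U).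
  - move=> x Fx; apply: contrapT => ncov; apply: nox; exists x => // U pU.
    by apply: contrapT => nUx; apply: ncov; exists U.
  pose U : Lat := \meet_(V <- D) V.
  have pU : sval p U.
    by apply/(prime_filter_meets _ pP) => V /Dp/set_mem.
  have [||E Ep UE] :=
      (cpt (sval U)).2 (svalP U).2 _ (~` sval p) (fun V => sval V).
  - by move=> V _; case: (svalP V).
  - move=> x Ux; apply: contrapT => Fx.
    have [V DV VNx] := FD _ Fx; apply: VNx.
    by move/(prime_filter_meets _ (prime_filter_point x)): Ux; exact.
  have /(prime_filter_joins _ pP)[V /Ep/set_mem] : sval p (\join_(V <- E) V).
    apply: prime_filter_le pP _ pU; apply/leLatE => x /UE[V EV Vx].
    by apply/(prime_filter_joins _ (prime_filter_point x)); exists V.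
  by [].
exists x; apply: spec_inj; apply/seteqP; split=> U /=; last exact: xp.
by move=> Ux; apply: contrapT => npU; apply: Fx; exists U.
Qed.

Definition point_hom : bitop_hom S (Spec Lat) := exist _ _ point_bicontinuous.

Lemma point_iso : SP S -> is_iso (point_hom : @hom BiTop S (Spec Lat)).
Proof.
move=> [sp1 sp2 sp3].
have [g gK] := choice (point_surj sp2).
have Kg x : g (point x) = x by apply: (point_inj sp1 sp3); rewrite gK.
(* Hence the preimage of [U] under [g] is [spec_pos U], and continuity of [g] can be checked on the
   bases of [SP1]. *)
have gU (p : Spec Lat) (U : Lat) : sval U (g p) = sval p U.
  by rewrite -[in RHS](gK p).
case: sp1 => -[_ basep] [_ basen].
have g_bicont : bicontinuous g.
  split; apply/continuousP => A; rewrite openE => Ao.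
    apply/open_posE => p Ap.
    have [U [LU Up] UA] := basep _ _ (Ao _ Ap).
    exists (exist _ U LU) => [|q qU]; first by rewrite /spec_pos /= -gU.
    by apply: UA; move: qU; rewrite /spec_pos /= -gU.
  apply/open_negE => p Ap.
  have [U [LU Up] UA] := basen _ _ (Ao _ Ap).
  exists (exist _ _ (LnegC LU)) => [|q qU].
    by rewrite /spec_neg /spec_pos /= -gU => /(_ Up).
  by apply: UA; move: qU; rewrite /spec_neg /spec_pos /= -gU => /contrapT.
exists (exist _ g g_bicont).
by split; apply: eq_exist; apply/funext => x /=; rewrite ?Kg ?gK.
Qed.

End positive_lattice.

(** * The two functors and the duality *)

Lemma spec_map_subproof (L M : dlat) (f : dlat_hom L M) (p : spec M) :
  prime_filter (sval f @^-1` sval p).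
Proof.
case: f p => f [fI fU f0 f1] [p [p1 p0 pI pU]]; split=> /=.
- by rewrite f1.
- by rewrite f0.
- by move=> x y; rewrite fI pI.
- by move=> x y; rewrite fU pU.
Qed.

Definition spec_map (L M : dlat) (f : dlat_hom L M) (p : Spec M) : Spec L :=
  exist _ _ (spec_map_subproof f p).

Lemma spec_map_bicontinuous (L M : dlat) (f : dlat_hom L M) :
  bicontinuous (spec_map f).
Proof.
split; apply: continuous_base => x; first exact: (@open_spec_pos _ (sval f x)).
exact: (@open_spec_neg _ (sval f x)).
Qed.

Definition SpecF : functor DLat (op BiTop).
Proof.
refine (@Functor DLat (op BiTop) Spec
  (fun L M f => exist _ _ (spec_map_bicontinuous f)) _ _).
- by move=> L; apply: eq_exist; apply/funext => p; exact: spec_inj.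
- by move=> *; apply: eq_exist; apply/funext => p; exact: spec_inj.
Defined.

Lemma Lat_map_subproof (S1 S2 : bitop) (f : bitop_hom S1 S2) (U : Lat S2) :
  Lpos S1 (sval f @^-1` sval U).
Proof.
case: f U => f [fp fn] [U [Uo Uc]]; split.
  exact: ((@continuousP (pos S1) (pos S2) f).1 fp _ Uo).
exact: ((@continuousP (neg S1) (neg S2) f).1 fn _ Uc).
Qed.

Definition Lat_map (S1 S2 : bitop) (f : bitop_hom S1 S2) (U : Lat S2) : Lat S1 :=
  exist _ _ (Lat_map_subproof f U).

Lemma Lat_map_morphism (S1 S2 : bitop) (f : bitop_hom S1 S2) :
  dlat_morphism (Lat_map f).
Proof. by split=> [U V|U V||]; exact: Lpos_carrier_inj. Qed.

Definition LatF : functor (op BiTop) DLat.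
Proof.
refine (@Functor (op BiTop) DLat Lat
  (fun S2 S1 f => exist _ _ (Lat_map_morphism f)) _ _).
- by move=> S; apply: eq_exist; apply/funext => U; exact: Lpos_carrier_inj.
- by move=> *; apply: eq_exist; apply/funext => U; exact: Lpos_carrier_inj.
Defined.

Definition basic (L : dlat) (x : L) : Lat (Spec L) :=
  exist _ _ (Lpos_spec_pos x).

Lemma basic_morphism (L : dlat) : dlat_morphism (@basic L).
Proof.
split=> [x y|x y||]; apply: Lpos_carrier_inj.
- exact: spec_posI.
- exact: spec_posU.
- exact: spec_pos0.
- exact: spec_pos1.
Qed.

Definition basic_hom (L : dlat) : dlat_hom L (Lat (Spec L)) :=
  exist _ _ (basic_morphism L).

(** Bijectivity comes from [Lpos_specP] and [spec_pos_inj], and the inverse of a bijective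
    homomorphism preserves the operations. *)
Lemma basic_iso (L : dlat) : is_iso (basic_hom L : @hom DLat L (Lat (Spec L))).
Proof.
have basic_surj (U : Lat (Spec L)) : exists x, basic x = U.
  by have [x xU] := Lpos_specP (svalP U); exists x; exact: Lpos_carrier_inj.
have [g gK] := choice basic_surj.
have Kg x : g (basic x) = x.
  by apply: spec_pos_inj; exact: (congr1 sval (gK (basic x))).
have [bI bU b0 b1] := basic_morphism L.
have g_morph : dlat_morphism g.
  split=> [U V|U V||].
  - by rewrite -[RHS]Kg bI !gK.
  - by rewrite -[RHS]Kg bU !gK.
  - by rewrite -[RHS]Kg b0.
  - by rewrite -[RHS]Kg b1.
exists (exist _ g g_morph).
by split; apply: eq_exist; apply/funext => x /=; rewrite ?Kg ?gK.
Qed.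

Lemma basic_natural (L M : dlat) (f : dlat_hom L M) :
  comp (basic_hom M : @hom DLat _ _) f =
  comp (fmap (comp_functor LatF SpecF) f) (basic_hom L).
Proof. by apply: eq_exist; apply/funext => x; exact: Lpos_carrier_inj. Qed.

Lemma point_natural (S1 S2 : op BiTop) (f : hom S1 S2) :
  comp (point_hom S2 : @hom (op BiTop) _ _)
    (fmap (comp_functor SpecF LatF) f) =
  comp f (point_hom S1 : @hom (op BiTop) (Spec (Lat S1)) S1).
Proof. by apply: eq_exist; apply/funext => x; exact: spec_inj. Qed.

Theorem corollary2p3p12 : dual DLat AbsSpec0 /\ dual DLat01 AbsSpec.
Proof.
split.
  (* The opposite of a full subcategory of [BiTop] is convertible to the full subcategory of
     [op BiTop] on the same objects. *)
  apply: (@equivalent_full_sub DLat (op BiTop) SP SpecF SP_Spec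
    (comp_functor LatF (@incl (op BiTop) SP))).
    exists basic_hom; split; [exact: basic_natural|exact: basic_iso].
  exists (fun S : AbsSpec0 => point_hom (sval S)).
  split=> [S1 S2 f|[S SPS]]; first exact: point_natural.
  (* Passing to [op] exchanges the two inverse laws, so the same [g] serves. *)
  by have [g [gK Kg]] := point_iso SPS; exists g.
(* Both functors restrict: nontrivial lattices have non-empty spectra, and non-empty spaces have
   nontrivial lattices. *)
have SpecP (L : DLat01) : abstract_spectrum (Spec (sval L)).
  by split; [exact: Spec_nonempty (svalP L)|exact: SP_Spec].
have LatP (S : AbsSpec) : nontrivial (Lat (sval S)).
  by apply: nontrivial_Lat; case: (svalP S).
apply: (@equivalent_full_sub DLat01 (op BiTop) abstract_spectrum
  (comp_functor SpecF (@incl DLat nontrivial)) SpecP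
  (corestrict (F := comp_functor LatF (@incl (op BiTop) abstract_spectrum)) LatP)).
  exists (fun L : DLat01 => basic_hom (sval L)).
  by split=> [L M f|L]; [exact: basic_natural|exact: basic_iso].
exists (fun S : AbsSpec => point_hom (sval S)).
split=> [S1 S2 f|[S [? SPS]]]; first exact: point_natural.
by have [g [gK Kg]] := point_iso SPS; exists g.
Qed.
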